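(* Let $G$ and $H$ be finite groups. Then $\mathcal{D}(G)\cong\mathcal{D}(H)$ as Hopf algebras if and only if $G\cong H$ as groups.
   Context: The base field $\mathbbm{k}$ is algebraically closed of characteristic zero. For a finite group $G$, $\mathbbm{k}^G$ is the linear dual of $\mathbbm{k}G$, with dual basis $\{e_g\}_{g\in G}$ and identity $\varepsilon=\sum_{g}e_g$. The Drinfeld double $\mathcal{D}(G)$ is the Hopf algebra with basis $e_g\# h$ ($g,h\in G$), multiplication $(e_g\# g')(e_h\# h')=\delta_{g,\,g'hg'^{-1}}\,e_g\# g'h'$, unit $\varepsilon\# 1$, and coalgebra structure $(\mathbbm{k}^G)^{\mathrm{cop}}\otimes\mathbbm{k}G$, i.e. $\Delta(e_g\# h)=\sum_{ab=g}(e_b\# h)\otimes(e_a\# h)$ with counit $e_g\# h\mapsto\delta_{g,1}$. *)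

(* Defs.v *)
From HB Require Import structures.
From mathcomp Require Import all_boot all_order all_algebra all_fingroup.
From mathcomp Require Import all_field.

Set Implicit Arguments.
Unset Strict Implicit.
Unset Printing Implicit Defensive.

Import GRing.Theory VectorInternalTheory.
Local Open Scope ring_scope.

(* Tensor products of finite-dimensional vector spaces are represented by     *)
(* coordinate matrices: v (x) w is the outer product of the coordinates of v  *)
(* and w. The coordinates matter only through [tens_lift], the linear map on  *)
(* V (x) W induced by a bilinear map; [tens_liftE] and [tens_eq] are the      *)
(* existence and uniqueness parts of the universal property.                  *)
Definition tens (k : fieldType) (V W : vectType k) : Type :=
  'M[k]_(dim V, dim W).
HB.instance Definition _ (k : fieldType) (V W : vectType k) :=
  Vector.copy (tens V W) 'M[k]_(dim V, dim W).

Section Tensor.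
Variables (k : fieldType) (V W : vectType k).

Definition pure_tens (v : V) (w : W) : tens V W := (v2r v)^T *m v2r w.

Definition coord_vect (U : vectType k) (i : 'I_(dim U)) : U :=
  r2v (delta_mx 0 i).

Definition tens_lift (U : lmodType k) (beta : V -> W -> U) (t : tens V W) : U :=
  \sum_i \sum_j (t : 'M[k]_(_, _)) i j *: beta (coord_vect i) (coord_vect j).

Lemma coord_vectE (U : vectType k) (u : U) :
  u = \sum_i v2r u 0 i *: coord_vect i.
Proof.
apply: v2r_inj; rewrite linear_sum /= [LHS]row_sum_delta.
by apply: eq_bigr => i _; rewrite linearZ /= r2vK.
Qed.

Fact pure_tens_linearr v : linear (pure_tens v).
Proof. by move=> a w w'; rewrite /pure_tens !linearP. Qed.

Fact pure_tens_linearl w : linear (pure_tens^~ w).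
Proof. by move=> a v v'; rewrite /pure_tens !linearP /= mulmxDl -scalemxAl. Qed.

Fact tens_lift_linear (U : lmodType k) (beta : V -> W -> U) :
  linear (tens_lift beta).
Proof.
move=> a s t; rewrite /tens_lift scaler_sumr -big_split /=.
apply: eq_bigr => i _; rewrite scaler_sumr -big_split /=.
by apply: eq_bigr => j _; rewrite !mxE scalerDl scalerA.
Qed.
HB.instance Definition _ (U : lmodType k) (beta : V -> W -> U) :=
  GRing.isLinear.Build k (tens V W) U *:%R (tens_lift beta)
    (tens_lift_linear beta).

Lemma tens_liftE (U : lmodType k) (beta : V -> W -> U) v w :
    (forall v, linear (beta v)) -> (forall w, linear (beta^~ w)) ->
  tens_lift beta (pure_tens v w) = beta v w.
Proof.
move=> linr linl.
pose br v := GRing.isLinear.Build k W U *:%R (beta v) (linr v).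
pose Br v : {linear W -> U} := HB.pack (beta v) (br v).
pose bl w := GRing.isLinear.Build k V U *:%R (beta^~ w) (linl w).
pose Bl w : {linear V -> U} := HB.pack (beta^~ w) (bl w).
have -> : beta v w = Bl w v by [].
rewrite {2}(coord_vectE v) linear_sum; apply: eq_bigr => i _.
rewrite linearZ /= -[beta _ w]/(Br (coord_vect i) w) {2}(coord_vectE w).
rewrite linear_sum scaler_sumr; apply: eq_bigr => j _.
by rewrite linearZ /= scalerA mxE big_ord1 mxE.
Qed.

Lemma tens_coordE (t : tens V W) :
  t = \sum_i \sum_j (t : 'M[k]_(_, _)) i j
        *: pure_tens (coord_vect i) (coord_vect j).
Proof.
rewrite [LHS]matrix_sum_delta; apply: eq_bigr => i _; apply: eq_bigr => j _.
congr (_ *: _); rewrite /pure_tens /coord_vect !r2vK trmx_delta.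
by rewrite mul_delta_mx.
Qed.

Lemma tens_eq (U : lmodType k) (f g : {linear tens V W -> U}) :
  (forall v w, f (pure_tens v w) = g (pure_tens v w)) -> f =1 g.
Proof.
move=> fg t; rewrite (tens_coordE t) !linear_sum; apply: eq_bigr => i _.
by rewrite !linear_sum; apply: eq_bigr => j _; rewrite !linearZ fg.
Qed.

End Tensor.

HB.instance Definition _ (k : fieldType) (V W : vectType k) (v : V) :=
  GRing.isLinear.Build k W (tens V W) *:%R (pure_tens v) (pure_tens_linearr v).

Declare Scope tens_scope.
Delimit Scope tens_scope with tens.
Notation "v \ox w" := (pure_tens v w)
  (at level 40, left associativity) : tens_scope.
Local Open Scope tens_scope.

Definition tens_map (k : fieldType) (V W V' W' : vectType k)
    (f : V -> V') (g : W -> W') : tens V W -> tens V' W' :=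
  tens_lift (fun v w => f v \ox g w).

Definition tens_assoc (k : fieldType) (U V W : vectType k) :
    tens (tens U V) W -> tens U (tens V W) :=
  tens_lift (fun s w => tens_lift (fun u v => u \ox (v \ox w)) s).

Definition tens_mul (k : fieldType) (A B : falgType k) (s t : tens A B) :
    tens A B :=
  tens_lift (fun a b => tens_lift (fun a' b' => (a * a') \ox (b * b')) t) s.

Section TensorOperations.
Variable k : fieldType.
Implicit Types U V W : vectType k.

Lemma pure_tens_suml V W I (r : seq I) (P : pred I) (F : I -> V) (w : W) :
  (\sum_(i <- r | P i) F i) \ox w = \sum_(i <- r | P i) F i \ox w.
Proof.
pose l := GRing.isLinear.Build k V (tens V W) *:%R _ (pure_tens_linearl w).
pose L : {linear V -> tens V W} := HB.pack (fun v => pure_tens v w) l.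
exact: (linear_sum L).
Qed.

Lemma pure_tens0l V W (w : W) : (0 : V) \ox w = 0.
Proof. by rewrite /pure_tens linear0 trmx0 mul0mx. Qed.

Lemma tens_mapE V W V' W' (f : {linear V -> V'}) (g : {linear W -> W'}) v w :
  tens_map f g (v \ox w) = f v \ox g w.
Proof.
rewrite /tens_map tens_liftE // => [v' c x y|w' c x y]; rewrite linearP.
  exact: pure_tens_linearr.
exact: pure_tens_linearl.
Qed.

Lemma tens_assocE U V W (u : U) (v : V) (w : W) :
  tens_assoc ((u \ox v) \ox w) = u \ox (v \ox w).
Proof.
have lift w' u' v' : tens_lift (fun u v => u \ox (v \ox w')) (u' \ox v') =
                     u' \ox (v' \ox w') :> tens U (tens V W).
  rewrite tens_liftE // => [u1 c x y|v1 c x y].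
    by rewrite pure_tens_linearl pure_tens_linearr.
  exact: pure_tens_linearl.
rewrite /tens_assoc tens_liftE ?lift // => [s c x y|w' c s t]; last first.
  exact: linearP.
rewrite /tens_lift scaler_sumr -big_split; apply: eq_bigr => i _ /=.
rewrite scaler_sumr -big_split; apply: eq_bigr => j _ /=.
by rewrite !pure_tens_linearr scalerDr !scalerA [_ * c]mulrC.
Qed.

Fact tens_map_linear V W V' W' (f : V -> V') (g : W -> W') :
  linear (tens_map f g).
Proof. exact: linearP. Qed.

Fact tens_assoc_linear U V W : linear (@tens_assoc k U V W).
Proof. exact: linearP. Qed.

Variables A B : falgType k.

Fact tens_mul_linearl (t : tens A B) : linear (@tens_mul k A B ^~ t).
Proof. exact: linearP. Qed.

Fact tens_mul_linearr (s : tens A B) : linear (tens_mul s).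
Proof.
move=> c t u; rewrite /tens_mul {1 3 5}/tens_lift scaler_sumr -big_split.
apply: eq_bigr => i _ /=; rewrite scaler_sumr -big_split.
by apply: eq_bigr => j _ /=; rewrite linearP scalerDr !scalerA [_ * c]mulrC.
Qed.

Lemma tens_mulE (a a' : A) (b b' : B) :
  tens_mul (a \ox b) (a' \ox b') = (a * a') \ox (b * b').
Proof.
have lift a1 b1 a2 b2 :
    tens_lift (fun a' b' => (a1 * a') \ox (b1 * b')) (a2 \ox b2) =
    (a1 * a2) \ox (b1 * b2) :> tens A B.
  rewrite tens_liftE // => [a3 c x y|b3 c x y].
    by rewrite mulrDr -scalerAr pure_tens_linearr.
  by rewrite mulrDr -scalerAr pure_tens_linearl.
rewrite /tens_mul tens_liftE ?lift // => [a1|b1] c x y;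
rewrite /tens_lift scaler_sumr -big_split; apply: eq_bigr => i _ /=;
rewrite scaler_sumr -big_split; apply: eq_bigr => j _ /=;
rewrite mulrDl -scalerAl.
  by rewrite pure_tens_linearr scalerDr !scalerA [_ * c]mulrC.
by rewrite pure_tens_linearl scalerDr !scalerA [_ * c]mulrC.
Qed.

End TensorOperations.

HB.instance Definition _ (k : fieldType) (V W V' W' : vectType k)
    (f : V -> V') (g : W -> W') :=
  GRing.isLinear.Build k (tens V W) (tens V' W') *:%R (tens_map f g)
    (tens_map_linear f g).
HB.instance Definition _ (k : fieldType) (U V W : vectType k) :=
  GRing.isLinear.Build k (tens (tens U V) W) (tens U (tens V W)) *:%R
    (@tens_assoc k U V W) (@tens_assoc_linear k U V W).
HB.instance Definition _ (k : fieldType) (A B : falgType k) (s : tens A B) :=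
  GRing.isLinear.Build k (tens A B) (tens A B) *:%R (tens_mul s)
    (tens_mul_linearr s).

HB.mixin Record Falgebra_isHopf (k : fieldType) A of Falgebra k A := {
  comul : {linear A -> tens A A};
  counit : {lrmorphism A -> k^o};
  antipode : {linear A -> A};
  comulA : forall x : A,
    tens_assoc (tens_map comul id (comul x)) = tens_map id comul (comul x);
  comul_counitl : forall x : A,
    tens_lift (fun a b : A => counit a *: b) (comul x) = x;
  comul_counitr : forall x : A,
    tens_lift (fun a b : A => counit b *: a) (comul x) = x;
  comul1 : comul 1 = 1 \ox 1;
  comulM : forall x y : A, comul (x * y) = tens_mul (comul x) (comul y);
  antipodel : forall x : A,
    tens_lift (fun a b : A => antipode a * b) (comul x) = counit x *: 1;
  antipoder : forall x : A,
    tens_lift (fun a b : A => a * antipode b) (comul x) = counit x *: 1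
}.

#[short(type="hopfType")]
HB.structure Definition Hopf (k : fieldType) :=
  { A of Falgebra k A & Falgebra_isHopf k A }.

Definition hopf_morphism (k : fieldType) (A B : hopfType k)
    (f : {lrmorphism A -> B}) : Prop :=
  [/\ forall x, comul (f x) = tens_map f f (comul x),
      forall x, counit (f x) = counit x :> k
    & forall x, antipode (f x) = f (antipode x)].

Definition hopf_isomorphic (k : fieldType) (A B : hopfType k) : Prop :=
  exists2 f : {lrmorphism A -> B}, hopf_morphism f & bijective f.

(* The basis element e_g # h of D(G) is the indicator function of (g, h).     *)
Definition drinfeld_double (k : fieldType) (gT : finGroupType) : Type :=
  {ffun gT * gT -> k^o}.
HB.instance Definition _ (k : fieldType) (gT : finGroupType) :=
  Vector.copy (drinfeld_double k gT) {ffun gT * gT -> k^o}.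

Section DrinfeldDouble.
Variables (k : fieldType) (gT : finGroupType).
Local Notation D := (drinfeld_double k gT).
Implicit Types (g h a b : gT) (x y z : D).

Definition dbasis g h : D := [ffun p => (p == (g, h))%:R].

Definition dlift (U : lmodType k) (F : gT -> gT -> U) (x : D) : U :=
  \sum_(p : gT * gT) (x : {ffun _ -> k^o}) p *: F p.1 p.2.

Fact dlift_linear (U : lmodType k) (F : gT -> gT -> U) : linear (dlift F).
Proof.
move=> c x y; rewrite /dlift scaler_sumr -big_split; apply: eq_bigr => p _.
by rewrite !ffunE scalerDl scalerA.
Qed.
HB.instance Definition _ (U : lmodType k) (F : gT -> gT -> U) :=
  GRing.isLinear.Build k D U *:%R (dlift F) (dlift_linear F).

Lemma dliftE (U : lmodType k) (F : gT -> gT -> U) g h :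
  dlift F (dbasis g h) = F g h.
Proof.
rewrite /dlift (bigD1 (g, h)) //= ffunE eqxx scale1r big1 ?addr0 // => p np.
by rewrite ffunE (negbTE np) scale0r.
Qed.

Lemma dbasisE x : x = dlift dbasis x.
Proof.
apply/ffunP=> p; rewrite /dlift sum_ffunE (bigD1 p) //= big1 => [|q nq].
  by rewrite !ffunE -surjective_pairing eqxx addr0 /GRing.scale /= mulr1.
by rewrite !ffunE -surjective_pairing eq_sym (negbTE nq) scaler0.
Qed.

Lemma double_eq (U : lmodType k) (f f' : D -> U) :
    linear f -> linear f' ->
  (forall g h, f (dbasis g h) = f' (dbasis g h)) -> f =1 f'.
Proof.
move=> lf lf' ff' x.
pose F : {linear D -> U} := HB.pack f (GRing.isLinear.Build k D U *:%R f lf).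
pose F' : {linear D -> U} :=
  HB.pack f' (GRing.isLinear.Build k D U *:%R f' lf').
rewrite -[f x]/(F x) -[f' x]/(F' x) (dbasisE x) !linear_sum.
by apply: eq_bigr => p _; rewrite !linearZ /= ff'.
Qed.

Definition dunit : D := \sum_g dbasis g 1%g.

Definition dmul x y : D :=
  dlift (fun g g' => dlift (fun h h' =>
    if g == (g' * h * g'^-1)%g then dbasis g (g' * h')%g else 0) y) x.

Definition dcomul : D -> tens D D :=
  dlift (fun g h =>
    \sum_(ab : gT * gT | (ab.1 * ab.2)%g == g) dbasis ab.2 h \ox dbasis ab.1 h).

Definition dcounit : D -> k^o := dlift (fun g _ => (g == 1%g)%:R : k^o).

(* S(e_g # h) = S(h) S(e_g), where S(e_g) = e_(g^-1) and S(h) = h^-1.         *)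
Definition dantipode : D -> D :=
  dlift (fun g h => dbasis (h^-1 * g^-1 * h)%g h^-1%g).

HB.instance Definition _ := GRing.Linear.copy dcomul (dlift _).
HB.instance Definition _ := GRing.Linear.copy dcounit (dlift _).
HB.instance Definition _ := GRing.Linear.copy dantipode (dlift _).

Fact dmul_linearr x : linear (dmul x).
Proof.
move=> c y z; rewrite /dmul {1 3 5}/dlift scaler_sumr -big_split.
apply: eq_bigr => p _; rewrite linearP /= scalerDr !scalerA.
by rewrite [_ * c]mulrC.
Qed.
HB.instance Definition _ x :=
  GRing.isLinear.Build k D D *:%R (dmul x) (dmul_linearr x).

Fact dmul_linearl y : linear (dmul^~ y).
Proof. by move=> c x z; rewrite /dmul linearP. Qed.

Lemma dmulE g g' h h' :
  dmul (dbasis g g') (dbasis h h') =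
    if g == (g' * h * g'^-1)%g then dbasis g (g' * h')%g else 0.
Proof. by rewrite /dmul !dliftE. Qed.

Fact dmulA : associative dmul.
Proof.
move=> x y z; rewrite -[LHS]/((dmul x \o dmul y) z) -[RHS]/(dmul (dmul x y) z).
move: z; apply: double_eq; [exact: linearP..|] => g3 h3 /=.
move: y; apply: (double_eq (f := fun y => dmul x (dmul y _))
  (f' := fun y => dmul (dmul x y) _)) => [c u v|c u v|g2 h2].
- by rewrite dmul_linearl linearP.
- by rewrite linearP dmul_linearl.
move: x; apply: (double_eq (f := fun x => dmul x (dmul _ _))
  (f' := fun x => dmul (dmul x _) _)) => [c u v|c u v|g1 h1].
- by rewrite dmul_linearl.
- by rewrite !dmul_linearl.
rewrite !dmulE.
have dmul0l u : dmul 0 u = 0 by rewrite /dmul linear0.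
case: eqP => [->|n2]; case: eqP => [->|n1];
  rewrite ?linear0 ?dmul0l ?dmulE ?eqxx //.
- by case: eqP => [_|[]]; rewrite ?invMg !mulgA.
- by case: eqP => // e; case: n1; rewrite e invMg !mulgA.
- case: eqP => // e; case: n2; move: e.
  rewrite invMg => /(congr1 (fun u => h1^-1 * u * h1)%g).
  by rewrite !mulgA !mulVg !mul1g !mulgKV.
Qed.

Fact dmul1l : left_id dunit dmul.
Proof.
apply: double_eq => [c x y|c x y|g h] //; first by rewrite linearP.
rewrite /dunit /dmul linear_sum (bigD1 g) //= big1 => [|a na].
  by rewrite !dliftE mul1g invg1 mulg1 eqxx mul1g addr0.
by rewrite !dliftE mul1g invg1 mulg1 (negbTE na).
Qed.

Fact dmul1r : right_id dunit dmul.
Proof.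
apply: (double_eq (f := dmul^~ _)) => [c x y|c x y|g h] //.
  by rewrite dmul_linearl.
rewrite /dunit linear_sum (bigD1 (h^-1 * g * h)%g) //= big1 => [|a na].
  by rewrite dmulE mulg1 addr0; case: eqP => // -[];
    rewrite !mulgA mulgV mul1g mulgK.
rewrite dmulE; case: eqP => // eg; case/eqP: na.
by rewrite eg !mulgA mulVg mul1g mulgKV.
Qed.

Fact dmulDl : left_distributive dmul +%R.
Proof. by move=> x y z; rewrite /dmul linearD. Qed.

Fact dmulDr : right_distributive dmul +%R.
Proof. by move=> x y z; rewrite linearD. Qed.

Fact dunit_neq0 : dunit != 0.
Proof.
apply/eqP=> /(congr1 (fun x : D => dlift (fun g _ => (g == 1%g)%:R : k^o) x)).
rewrite linear0 linear_sum (bigD1 1%g) //= dliftE eqxx big1 => [|a na].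
  by rewrite addr0 => /eqP; rewrite oner_eq0.
by rewrite dliftE (negbTE na).
Qed.

HB.instance Definition _ := GRing.Zmodule_isNzRing.Build D
  dmulA dmul1l dmul1r dmulDl dmulDr dunit_neq0.

Fact dscaleAl (c : k) x y : c *: (x * y) = (c *: x) * y.
Proof. by rewrite -[RHS]/(dmul _ _) /dmul linearZ. Qed.
HB.instance Definition _ := GRing.Lmodule_isLalgebra.Build k D dscaleAl.

Fact dscaleAr (c : k) x y : c *: (x * y) = x * (c *: y).
Proof. by rewrite -[RHS]/(dmul _ _) linearZ. Qed.
HB.instance Definition _ := GRing.Lalgebra_isAlgebra.Build k D dscaleAr.

HB.instance Definition _ := Algebra_isFalgebra.Build k D.

Lemma dbasisM g g' h h' :
  dbasis g g' * dbasis h h' =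
    if g == (g' * h * g'^-1)%g then dbasis g (g' * h')%g else 0.
Proof. exact: dmulE. Qed.

Lemma dunitE : 1 = \sum_g dbasis g 1%g :> D. Proof. by []. Qed.

Lemma dcomulE g h :
  dcomul (dbasis g h) =
    \sum_(ab : gT * gT | (ab.1 * ab.2)%g == g) dbasis ab.2 h \ox dbasis ab.1 h.
Proof. exact: dliftE. Qed.

Lemma dcounitE g h : dcounit (dbasis g h) = (g == 1%g)%:R.
Proof. exact: dliftE. Qed.

Lemma dantipodeE g h :
  dantipode (dbasis g h) = dbasis (h^-1 * g^-1 * h)%g h^-1%g.
Proof. exact: dliftE. Qed.

Lemma dcomulE1 g h :
  dcomul (dbasis g h) = \sum_a dbasis (a^-1 * g)%g h \ox dbasis a h.
Proof.
rewrite dcomulE (reindex (fun a => (a, a^-1 * g)%g)) /=.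
  by apply: eq_bigl => a; rewrite mulKVg eqxx.
exists fst => [a|[a b]] //=; rewrite inE /= => /eqP <-; by rewrite mulKg.
Qed.

Fact dcomulA x :
  tens_assoc (tens_map dcomul id (dcomul x)) =
  tens_map id dcomul (dcomul x).
Proof.
move: x; apply: double_eq => [c x y|c x y|g h]; rewrite ?linearP //.
have mapl (a b : D) : tens_map dcomul id (a \ox b) = dcomul a \ox b.
  exact: (tens_mapE dcomul idfun).
have mapr (a b : D) : tens_map id dcomul (a \ox b) = a \ox dcomul b.
  exact: (tens_mapE idfun dcomul).
rewrite dcomulE1 (linear_sum (tens_map dcomul id)) linear_sum /=.
rewrite (linear_sum (tens_map id dcomul)) /=.
under eq_bigr => a _.
  rewrite mapl dcomulE1 pure_tens_suml
    (linear_sum (@tens_assoc _ _ _ _)) /=.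
  under eq_bigr => c _ do rewrite tens_assocE.
  over.
under [RHS]eq_bigr => a _.
  rewrite mapr dcomulE1 linear_sum /=.
  over.
rewrite [RHS]exchange_big /=; apply: eq_bigr => a _.
rewrite [RHS](reindex_inj (mulgI a)) /=; apply: eq_bigr => c _.
by rewrite invMg !mulgA mulVg mul1g.
Qed.

Fact dcounit_linear : linear dcounit. Proof. exact: linearP. Qed.

Fact dcounit_monoid : monoid_morphism dcounit.
Proof.
split.
  rewrite dunitE linear_sum (bigD1 1%g) //= dcounitE eqxx big1 ?addr0 //.
  by move=> a na; rewrite dcounitE (negbTE na).
move=> x y; move: x.
apply: (double_eq (U := k^o) (f := fun x => dcounit (x * y))
  (f' := fun x => dcounit x * dcounit y)) => [c x z|c x z|g g'].
- by rewrite mulrDl -scalerAl linearP.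
- by rewrite linearP mulrDl scalerAl.
move: y; apply: (double_eq (U := k^o) (f := fun y => dcounit (_ * y))
  (f' := fun y => dcounit _ * dcounit y)) => [c x z|c x z|h h'].
- by rewrite mulrDr -scalerAr linearP.
- by rewrite linearP mulrDr scalerAr.
rewrite dbasisM !dcounitE.
have [->|g1] := eqVneq g 1%g; last first.
  by case: ifP => _; rewrite ?linear0 ?mul0r // dcounitE (negbTE g1).
rewrite mul1r -(inj_eq (mulgI g'^-1)%g) -(inj_eq (mulIg g')) mulg1.
rewrite !mulgA mulVg mul1g mulgKV eq_sym.
by case: ifP => _; rewrite ?linear0 // dcounitE eqxx.
Qed.
HB.instance Definition _ :=
  GRing.isMonoidMorphism.Build D k^o dcounit dcounit_monoid.

Fact dcomul_counitl x :
  tens_lift (fun a b : D => dcounit a *: b) (dcomul x) = x.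
Proof.
move: x; apply: (double_eq (f := fun x => tens_lift _ (dcomul x))
  (f' := idfun)) => [c x y|c x y|g h]; rewrite ?linearP //.
have lift (a b : D) : tens_lift (fun a b : D => dcounit a *: b) (a \ox b) =
    dcounit a *: b.
  rewrite tens_liftE // => [a'|b'] c x y; first exact: linearP.
  by rewrite linearP scalerDl scalerA.
rewrite dcomulE1 linear_sum /=; under eq_bigr => a _ do rewrite lift dcounitE.
rewrite (bigD1 g) //= mulVg eqxx scale1r big1 ?addr0 // => a na.
by rewrite -eq_mulVg1 (negbTE na) scale0r.
Qed.

Fact dcomul_counitr x :
  tens_lift (fun a b : D => dcounit b *: a) (dcomul x) = x.
Proof.
move: x; apply: (double_eq (f := fun x => tens_lift _ (dcomul x))
  (f' := idfun)) => [c x y|c x y|g h]; rewrite ?linearP //.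
have lift (a b : D) : tens_lift (fun a b : D => dcounit b *: a) (a \ox b) =
    dcounit b *: a.
  rewrite tens_liftE // => [a'|b'] c x y; last exact: linearP.
  by rewrite linearP scalerDl scalerA.
rewrite dcomulE1 linear_sum /=; under eq_bigr => a _ do rewrite lift dcounitE.
rewrite (bigD1 1%g) //= eqxx invg1 mul1g scale1r big1 ?addr0 // => a na.
by rewrite (negbTE na) scale0r.
Qed.

Fact dcomul1 : dcomul 1 = 1 \ox 1.
Proof.
rewrite dunitE pure_tens_suml linear_sum /=.
under eq_bigr => g _ do rewrite dcomulE1.
under [RHS]eq_bigr => g _ do rewrite linear_sum.
rewrite exchange_big [RHS]exchange_big; apply: eq_bigr => a _ /=.
by rewrite (reindex_inj (mulgI a)) /=; apply: eq_bigr => b _; rewrite mulKg.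
Qed.

Fact dcomulM x y : dcomul (x * y) = tens_mul (dcomul x) (dcomul y).
Proof.
move: x; apply: (double_eq (f := fun x => dcomul (x * y))
  (f' := fun x => tens_mul (dcomul x) (dcomul y))) => [c x z|c x z|g g'].
- by rewrite mulrDl -scalerAl linearP.
- by rewrite linearP tens_mul_linearl.
move: y; apply: (double_eq (f := fun y => dcomul (_ * y))
  (f' := fun y => tens_mul (dcomul _) (dcomul y))) => [c x z|c x z|h h'].
- by rewrite mulrDr -scalerAr linearP.
- by rewrite !linearP.
rewrite dbasisM !dcomulE1.
have tens_mul_suml I (r : seq I) (F : I -> tens D D) t :
    tens_mul (\sum_(i <- r) F i) t = \sum_(i <- r) tens_mul (F i) t.
  by rewrite /tens_mul linear_sum.
rewrite tens_mul_suml.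
have term a : tens_mul (dbasis (a^-1 * g) g' \ox dbasis a g')
      (\sum_b dbasis (b^-1 * h) h' \ox dbasis b h') =
    if g == (g' * h * g'^-1)%g
    then dbasis (a^-1 * g) (g' * h') \ox dbasis a (g' * h') else 0.
  rewrite linear_sum (bigD1 (g'^-1 * a * g')%g) //= big1 => [|b nb]; last first.
    rewrite tens_mulE !dbasisM [a == _](_ : _ = false) ?linear0 //.
    apply/eqP=> ea; case/eqP: nb.
    by rewrite ea !mulgA mulVg mul1g mulgKV.
  rewrite addr0 tens_mulE !dbasisM.
  have -> : (a == g' * (g'^-1 * a * g') * g'^-1)%g.
    by apply/eqP; rewrite !mulgA mulgV mul1g mulgK.
  have -> : (a^-1 * g == g' * ((g'^-1 * a * g')^-1 * h) * g'^-1)%g =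
            (g == g' * h * g'^-1)%g.
    rewrite -[RHS](inj_eq (mulgI a^-1%g)); congr (_ == _).
    by rewrite !invMg invgK !mulgA mulgV mul1g.
  by case: ifP => _; rewrite ?pure_tens0l.
under eq_bigr => a _ do rewrite term.
case: ifP => _; last by rewrite big1_eq linear0.
exact: dcomulE1.
Qed.

Fact dantipodel x :
  tens_lift (fun a b : D => dantipode a * b) (dcomul x) = dcounit x *: 1.
Proof.
move: x; apply: (double_eq (f := fun x => tens_lift _ (dcomul x))
  (f' := fun x => dcounit x *: 1)) => [c x y|c x y|g h]; rewrite ?linearP //.
  by rewrite scalerDl scalerA.
have lift (a b : D) : tens_lift (fun a b : D => dantipode a * b) (a \ox b) =
    dantipode a * b.
  rewrite tens_liftE // => [a'|b'] c x y; first by rewrite mulrDr -scalerAr.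
  by rewrite linearP mulrDl -scalerAl.
rewrite dcomulE1 linear_sum /= dcounitE.
under eq_bigr => a _ do rewrite lift dantipodeE dbasisM invgK mulVg invMg invgK.
rewrite dunitE scaler_sumr (reindex_inj (conjg_inj h^-1%g)) /=.
apply: eq_bigr => a _; rewrite conjgE invgK.
have -> : (h^-1 * (g^-1 * (h * (a * h^-1))) * h ==
           h^-1 * (h * (a * h^-1)) * h)%g = (g == 1%g).
  rewrite (inj_eq (mulIg h)) (inj_eq (mulgI h^-1%g)) -[RHS]eq_invg1.
  by rewrite -[X in _ == X]mul1g (inj_eq (mulIg _)).
have [->|g1] := eqVneq g 1%g; last by rewrite scale0r.
by rewrite scale1r invg1 mul1g mulKg mulgKV.
Qed.

Fact dantipoder x :
  tens_lift (fun a b : D => a * dantipode b) (dcomul x) = dcounit x *: 1.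
Proof.
move: x; apply: (double_eq (f := fun x => tens_lift _ (dcomul x))
  (f' := fun x => dcounit x *: 1)) => [c x y|c x y|g h]; rewrite ?linearP //.
  by rewrite scalerDl scalerA.
have lift (a b : D) : tens_lift (fun a b : D => a * dantipode b) (a \ox b) =
    a * dantipode b.
  rewrite tens_liftE // => [a'|b'] c x y; last by rewrite mulrDl -scalerAl.
  by rewrite linearP mulrDr -scalerAr.
rewrite dcomulE1 linear_sum /= dcounitE.
under eq_bigr => a _ do rewrite lift dantipodeE dbasisM mulgV.
rewrite dunitE scaler_sumr (reindex_inj invg_inj) /=.
apply: eq_bigr => a _; rewrite invgK.
have -> : (a * g == h * (h^-1 * a * h) * h^-1)%g = (g == 1%g).
  by rewrite !mulgA mulgV mul1g mulgK -[X in _ == X]mulg1 (inj_eq (mulgI _)).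
have [->|g1] := eqVneq g 1%g; last by rewrite scale0r.
by rewrite scale1r mulg1.
Qed.

HB.instance Definition _ := Falgebra_isHopf.Build k D
  dcomulA dcomul_counitl dcomul_counitr dcomul1 dcomulM dantipodel dantipoder.

End DrinfeldDouble.

(* Main.v *)
From HB Require Import structures.
Require Import Defs.
From mathcomp Require Import all_boot all_algebra all_fingroup.
From mathcomp Require Import all_solvable all_field.

(* The grouplike elements of D(G) are the sum_a chi(a) e_a # g with g in G    *)
(* and chi a linear character of G, and they form the group G x G^, where G^  *)
(* = Hom(G, k^* ). So D(G) = D(H) gives a group isomorphism G x G^ = H x H^.  *)
(* Write h(X, Y) = #|Hom(X, Y)|. As finite abelian groups are self-dual,      *)
(* h(G x G^, X^) = h(G, X^) h(G^, X^) = h(X, G^)^2, hence h(X, G^) =          *)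
(* h(X, H^), and cancelling this factor in h(X, G x G^) = h(X, G) h(X, G^)    *)
(* gives h(X, G) = h(X, H) for every finite group X. By Lovasz's theorem,     *)
(* G = H.                                                                     *)

Set Implicit Arguments.
Unset Strict Implicit.
Unset Printing Implicit Defensive.

Import GroupScope.

(** * Counting homomorphisms of finite groups *)

(** A group isomorphism relabels the basis of D(G), which is the easy direction
    ([hopf_isomorphic_drelabel]). Conversely, a Hopf isomorphism restricts to the grouplikes and
    gives G x G^ = H x H^ ([hopf_isomorphic_grouplike]). The factors G^ and H^ are not known to
    agree beforehand, so they are compared by counting homomorphisms ([card_hom_of_prod_dual]): into
    X^, both factors of G x G^ contribute h(X, G^), by exchanging variables ([card_hom_dualC]) and
    by self-duality of finite abelian groups ([card_hom_dual]). Once h(X, G^) = h(X, H^), this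
    factor cancels from the count of maps out of X. Equal counts for all X force G = H
    ([isog_of_card_hom]): sorting maps by kernel shows that injective maps are equally many, so each
    group embeds in the other. Characters are written additively in Z/(n+1), with one primitive root
    of unity of order n+1 = |G||H| serving both groups. *)

Definition hom (X Y : finGroupType) : predArgType :=
  {f : {ffun X -> Y} | [forall x, forall y, f (x * y) == f x * f y]}.
HB.instance Definition _ (X Y : finGroupType) := Finite.on (hom X Y).

Definition homfun (X Y : finGroupType) (f : hom X Y) : X -> Y := val f.
Coercion homfun : hom >-> Funclass.

Section Hom.
Variables X Y : finGroupType.

Lemma hom_subproof (f : X -> Y) : {morph f : x y / x * y} ->
  [forall x, forall y, finfun f (x * y) == finfun f x * finfun f y].
Proof. by move=> fM; apply/'forall_forallP=> x y; rewrite !ffunE fM. Qed.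

Definition mkhom (f : X -> Y) (fM : {morph f : x y / x * y}) : hom X Y :=
  exist _ (finfun f) (hom_subproof fM).

Lemma mkhomE f fM x : @mkhom f fM x = f x.
Proof. exact: ffunE. Qed.

Lemma homM (f : hom X Y) : {morph f : x y / x * y}.
Proof. by move=> x y; case: f => f fP; apply/eqP/(forallP (forallP fP x)). Qed.

Lemma hom1 (f : hom X Y) : f 1 = 1.
Proof. by apply: (mulgI (f 1)); rewrite -homM !mulg1. Qed.

Lemma homV (f : hom X Y) : {morph f : x / x^-1}.
Proof. by move=> x; apply: (mulgI (f x)); rewrite -homM !mulgV hom1. Qed.

Lemma homX (f : hom X Y) n : {morph f : x / x ^+ n}.
Proof. by move=> x; elim: n => [|n IH]; rewrite ?hom1 // !expgS homM IH. Qed.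

Lemma hom_eq (f g : hom X Y) : f =1 g -> f = g.
Proof. by move=> fg; apply/val_inj/ffunP. Qed.

End Hom.

Section Compose.
Variables X Y Z : finGroupType.

Lemma comp_subproof (g : hom Y Z) (f : hom X Y) :
  {morph g \o f : x y / x * y}.
Proof. by move=> x y; rewrite /= !homM. Qed.

Definition hom_comp (g : hom Y Z) (f : hom X Y) : hom X Z :=
  mkhom (comp_subproof g f).

Lemma hom_compE (g : hom Y Z) (f : hom X Y) x : hom_comp g f x = g (f x).
Proof. exact: mkhomE. Qed.

End Compose.

Lemma hom_inverse (X Y : finGroupType) (f : hom X Y) : bijective f ->
  exists g : hom Y X, cancel f g /\ cancel g f.
Proof.
case=> g fK gK; have gM : {morph g : x y / x * y}.
  by move=> x y; apply: (can_inj fK); rewrite homM !gK.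
by exists (mkhom gM); split=> x; rewrite mkhomE.
Qed.

Lemma isog_of_hom (X Y : finGroupType) (f : hom X Y) :
  injective f -> #|X| = #|Y| -> [set: X] \isog [set: Y].
Proof.
move=> f_inj cXY; pose m := Morphism (D := [set: X]) (in2W (homM f)).
have m_inj : 'injm m by apply/injmP=> x y _ _; apply: f_inj.
apply/isogP; exists m => //.
by apply/eqP; rewrite eqEcard subsetT card_injm ?cardsT ?cXY //=.
Qed.

Section CardHom.

Lemma card_hom_dom (X X' Y : finGroupType) (f : hom X X') :
  bijective f -> #|hom X Y| = #|hom X' Y|.
Proof.
case/hom_inverse=> g [fK gK].
apply: (bij_eq_card (f := fun u => hom_comp u g)).
exists (fun u => hom_comp u f) => u; apply/hom_eq=> x.
  by rewrite !hom_compE fK.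
by rewrite !hom_compE gK.
Qed.

Lemma card_hom_codom (X Y Y' : finGroupType) (f : hom Y Y') :
  bijective f -> #|hom X Y| = #|hom X Y'|.
Proof.
case/hom_inverse=> g [fK gK].
apply: (bij_eq_card (f := fun u => hom_comp f u)).
exists (fun u => hom_comp g u) => u; apply/hom_eq=> x.
  by rewrite !hom_compE fK.
by rewrite !hom_compE gK.
Qed.

Lemma card_hom_prod_codom (X Y Z : finGroupType) :
  #|hom X (Y * Z)%type| = (#|hom X Y| * #|hom X Z|)%N.
Proof.
have pM (p : hom X Y * hom X Z) :
    {morph (fun x => (p.1 x, p.2 x)) : x y / x * y}.
  by move=> x y; rewrite !homM.
have fM (f : hom X (Y * Z)%type) : {morph (fun x => (f x).1) : x y / x * y}.
  by move=> x y; rewrite !homM.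
have sM (f : hom X (Y * Z)%type) : {morph (fun x => (f x).2) : x y / x * y}.
  by move=> x y; rewrite !homM.
rewrite -card_prod.
apply: (bij_eq_card (f := fun f => (mkhom (fM f), mkhom (sM f)))).
exists (fun p => mkhom (pM p)) => [f|[f g]].
  by apply/hom_eq=> x; rewrite !mkhomE /= ?mkhomE -surjective_pairing.
by congr pair; apply/hom_eq=> x; rewrite !mkhomE.
Qed.

Lemma pairM (A B : finGroupType) (a a' : A) (b b' : B) :
  (a, b) * (a', b') = (a * a', b * b').
Proof. by []. Qed.

Lemma card_hom_prod_dom (A B Y : finGroupType) : commutative (@mulg Y) ->
  #|hom (A * B)%type Y| = (#|hom A Y| * #|hom B Y|)%N.
Proof.
move=> Yc.
have pM (p : hom A Y * hom B Y) :
    {morph (fun x => p.1 x.1 * p.2 x.2) : x y / x * y}.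
  move=> x y; rewrite !homM -!mulgA; congr (_ * _).
  by rewrite !mulgA [X in X * _ = _]Yc.
have fM (f : hom (A * B)%type Y) : {morph (fun x => f (x, 1)) : x y / x * y}.
  by move=> x y; rewrite -homM pairM mulg1.
have sM (f : hom (A * B)%type Y) : {morph (fun x => f (1, x)) : x y / x * y}.
  by move=> x y; rewrite -homM pairM mulg1.
rewrite -card_prod.
apply: (bij_eq_card (f := fun f => (mkhom (fM f), mkhom (sM f)))).
exists (fun p => mkhom (pM p)) => [f|[f g]].
  apply/hom_eq=> -[x y]; rewrite !mkhomE /= ?mkhomE -homM.
  by rewrite pairM mulg1 mul1g.
by congr pair; apply/hom_eq=> x; rewrite !mkhomE /= hom1 ?mulg1 ?mul1g.
Qed.

End CardHom.

(* The values lie in the cyclic group of order n.+1, which stands for the     *)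
(* n.+1-st roots of unity of k; this is the whole character group when the    *)
(* exponent of X divides n.+1.                                                *)
Definition dual (n : nat) (X : finGroupType) : predArgType := hom X 'I_n.+1.
HB.instance Definition _ n (X : finGroupType) := Finite.on (dual n X).
Identity Coercion dual_hom : dual >-> hom.

Section Dual.
Variables (n : nat) (X : finGroupType).
Implicit Types u v w : dual n X.

Lemma dual_mul_subproof u v : {morph (fun x => u x * v x) : x y / x * y}.
Proof.
move=> x y; rewrite !homM -!mulgA; congr (_ * _).
by rewrite !mulgA; congr (_ * _); apply: Zp_mulgC.
Qed.

Lemma dual_one_subproof : {morph (fun _ : X => 1 : 'I_n.+1) : x y / x * y}.
Proof. by move=> x y; rewrite mulg1. Qed.

Lemma dual_inv_subproof u : {morph (fun x => (u x)^-1) : x y / x * y}.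
Proof. by move=> x y; rewrite homM invMg; apply: Zp_mulgC. Qed.

Definition dual_mul u v : dual n X := mkhom (dual_mul_subproof u v).
Definition dual_one : dual n X := mkhom dual_one_subproof.
Definition dual_inv u : dual n X := mkhom (dual_inv_subproof u).

Fact dual_mulA : associative dual_mul.
Proof. by move=> u v w; apply/hom_eq=> x; rewrite !mkhomE mulgA. Qed.

Fact dual_mul1 : left_id dual_one dual_mul.
Proof. by move=> u; apply/hom_eq=> x; rewrite !mkhomE mul1g. Qed.

Fact dual_mulV : left_inverse dual_one dual_inv dual_mul.
Proof. by move=> u; apply/hom_eq=> x; rewrite !mkhomE mulVg. Qed.

HB.instance Definition _ :=
  Finite_isGroup.Build (dual n X) dual_mulA dual_mul1 dual_mulV.

Lemma dualM u v x : (u * v : dual n X) x = u x * v x.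
Proof. exact: mkhomE. Qed.

Lemma dual1 x : (1 : dual n X) x = 1.
Proof. exact: mkhomE. Qed.

Lemma dual_exp u m x : (u ^+ m : dual n X) x = u x ^+ m.
Proof. by elim: m => [|m IH]; rewrite ?dual1 // !expgS dualM IH. Qed.

Lemma dual_mulC : commutative (@mulg (dual n X)).
Proof. by move=> u v; apply/hom_eq=> x; rewrite !dualM; apply: Zp_mulgC. Qed.

Lemma dual_expn u : u ^+ n.+1 = 1.
Proof.
apply/hom_eq=> x; rewrite dual_exp dual1; apply/eqP.
by rewrite -order_dvdn -[X in _ %| X]card_ord -cardsT order_dvdG ?inE.
Qed.

Lemma dualJ u x y : u (x ^ y) = u x.
Proof. by rewrite conjgE !homM homV [LHS]Zp_mulgC -mulgA mulgV mulg1. Qed.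

End Dual.

(** Both sides count the pairings X x Y -> Z/(n+1) that are multiplicative in each variable. *)
Lemma card_hom_dualC n (X Y : finGroupType) :
  #|hom X (dual n Y)| = #|hom Y (dual n X)|.
Proof.
have sM (A B : finGroupType) (f : hom A (dual n B)) b :
    {morph (fun a => (f a : dual n B) b) : x y / x * y}.
  by move=> x y; rewrite homM dualM.
have swM (A B : finGroupType) (f : hom A (dual n B)) :
    {morph (fun b => mkhom (sM A B f b) : dual n A) : x y / x * y}.
  by move=> x y; apply/hom_eq=> a; rewrite dualM !mkhomE homM.
apply: (bij_eq_card (f := fun f => mkhom (swM X Y f))).
by exists (fun f => mkhom (swM Y X f)) => f; apply/hom_eq=> x; apply/hom_eq=> y;
  rewrite !mkhomE.
Qed.

Lemma hom_inj (X Y : finGroupType) (f : hom X Y) :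
  (forall x, f x = 1 -> x = 1) -> injective f.
Proof.
move=> ker1 x y /eqP; rewrite eq_mulgV1 -homV -homM => /eqP/ker1/eqP.
by rewrite -eq_mulgV1 => /eqP.
Qed.

(** * Self-duality of finite abelian groups *)

Section Cyclic.
Variables (A : finGroupType) (a : A).
Hypothesis genA : [set: A] = <[a]>.

Lemma in_gen x : x \in <[a]>. Proof. by rewrite -genA inE. Qed.

Definition hom_of_gen (Y : finGroupType) (y : Y) (dvd_y_a : #[y] %| #[a]) :
  hom A Y := mkhom (fun x1 x2 => eltmM dvd_y_a (in_gen x1) (in_gen x2)).

Lemma card_hom_cyclic (Y : finGroupType) :
  #|hom A Y| = #|[set y : Y | y ^+ #[a] == 1]|.
Proof.
have ev_inj : injective (fun f : hom A Y => f a).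
  move=> f g fg; apply/hom_eq=> x; have /cycleP[i ->] := in_gen x.
  by rewrite !homX fg.
rewrite -cardsT -(card_imset _ ev_inj); apply: eq_card => y; rewrite inE.
apply/imsetP/idP=> [[f _ ->]|]; first by rewrite -homX expg_order hom1.
rewrite -order_dvdn => dvd_y; exists (hom_of_gen dvd_y) => //.
by rewrite mkhomE eltm_id.
Qed.

(** A map from A to X^ is an element of X^ killed by the order of [a], that is, a map from X into
    the subgroup of Z/(n+1) killed by this order. That subgroup is the image of A under [iota]. *)
Lemma card_hom_dual_cyclic n (X : finGroupType) : #[a] %| n.+1 ->
  #|hom A (dual n X)| = #|hom X A|.
Proof.
move=> dvd_a; pose c : 'I_n.+1 := Zp1 ^+ (n.+1 %/ #[a]).
have order_c : #[c] = #[a].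
  by rewrite orderXdiv order_Zp1 ?dvdn_div // divnA // mulKn.
have dvd_c : #[c] %| #[a] by rewrite order_c.
pose iota := hom_of_gen dvd_c.
have iotaX i : iota (a ^+ i) = c ^+ i by rewrite mkhomE eltmE.
have iota_inj : injective iota.
  apply: hom_inj => x; have /cycleP[i ->] := in_gen x; rewrite iotaX.
  by move/eqP; rewrite -order_dvdn order_c order_dvdn => /eqP.
have iota_im (d : 'I_n.+1) : d ^+ #[a] = 1 -> exists x, iota x = d.
  move/eqP; rewrite -order_dvdn -order_c => dvd_d.
  (* In a cyclic group, inclusion of subgroups amounts to divisibility of their orders. *)
  have: <[d]> \subset <[c]>.
    rewrite -(cardSg_cyclic (G := [set: 'I_n.+1])) ?subsetT //.
    by apply/cyclicP; exists Zp1; apply: Zp_cycle.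
  by rewrite cycle_subG => /cycleP[i ->]; exists (a ^+ i).
rewrite card_hom_cyclic.
have comp_inj : injective (fun f : hom X A => hom_comp iota f : dual n X).
  move=> f g fg; apply/hom_eq=> x; apply: iota_inj.
  by rewrite -!hom_compE fg.
rewrite -[RHS]cardsT -(card_imset _ comp_inj); apply: eq_card => /= u.
rewrite inE; apply/eqP/imsetP=> [u1|[f _ ->]]; last first.
  apply/hom_eq=> x; rewrite dual_exp dual1 hom_compE -homX.
  have /cycleP[i ->] := in_gen ((f : hom X A) x).
  by rewrite expgAC expg_order expg1n hom1.
have [x|g gP] := fin_all_exists (P := fun x y => iota y = (u : dual n X) x).
  by apply: iota_im; rewrite -dual_exp u1 dual1.
have gM : {morph g : x y / x * y}.
  by move=> x y; apply: iota_inj; rewrite homM !gP homM.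
by exists (mkhom gM) => //; apply/hom_eq=> x; rewrite hom_compE mkhomE gP.
Qed.

End Cyclic.

Lemma card_subg_of (gT : finGroupType) (H : {group gT}) : #|subg_of H| = #|H|.
Proof. by rewrite -[LHS]cardsT -(card_injm (injm_sgval H)) // im_sgval. Qed.

(** Induction on |A|: an element whose order is the exponent of A spans a direct factor, and both
    counts are multiplicative over A = <x> x H, the left one because X^ is abelian. *)
Lemma card_hom_dual n (A X : finGroupType) :
    commutative (@mulg A) -> (forall a : A, a ^+ n.+1 = 1) ->
  #|hom A (dual n X)| = #|hom X A|.
Proof.
have [m] := ubnP #|A|; elim: m A => // m IHm A ltAm Ac expA.
have abA : abelian [set: A] by apply/centsP=> x _ y _; apply: Ac.
have [x _ exp_x] := exponent_witness (abelian_nil abA).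
have dvd_x : #[x] %| n.+1 by rewrite order_dvdn expA.
have [genA|ngenA] := eqVneq [set: A] <[x]>.
  exact: card_hom_dual_cyclic genA _ _ dvd_x.
have lt_x : #|<[x]>| < #|A|.
  by rewrite -cardsT proper_card // properEneq eq_sym ngenA subsetT.
(* Exponent 1 would make A trivial, hence equal to <x>. So the complement H is strictly smaller than
   A. *)
have x_gt1 : 1 < #[x].
  rewrite ltn_neqAle order_gt0 andbT eq_sym -exp_x.
  apply: contraNneq ngenA => e1.
  rewrite eqEsubset subsetT andbT; apply/subsetP=> y _.
  have := dvdn_exponent (in_setT y).
  by rewrite e1 dvdn1 order_eq1 => /eqP->; apply: group1.
have /splitsP[H /complP[tiH defA]] :=
  abelian_splits (in_setT x) (esym exp_x) abA.
have cardA : (#|<[x]>| * #|H| = #|A|)%N by rewrite -TI_cardMg // defA cardsT.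
have lt_H : #|H| < #|A| by rewrite -cardA -[X in X < _]mul1n ltn_pmul2r.
have mulM : {morph (fun p : subg_of <[x]> * subg_of H => sgval p.1 * sgval p.2)
    : p q / p * q}.
  case=> [p1 p2] [q1 q2] /=; rewrite -!mulgA; congr (_ * _).
  by rewrite !mulgA [X in X * _ = _]Ac.
pose f := mkhom mulM.
have f_bij : bijective f.
  apply: inj_card_bij; last by rewrite card_prod !card_subg_of cardA.
  apply: hom_inj => -[u v]; rewrite mkhomE /= => /eqP.
  rewrite -eq_invg_mul => /eqP uv.
  have : sgval v \in <[x]> :&: H by rewrite inE -{1}uv groupV !subgP.
  rewrite tiH => /set1P v1; move: uv; rewrite v1 => /eqP.
  rewrite invg_eq1 => /eqP u1.
  by congr pair; apply: val_inj.
rewrite -(card_hom_dom _ f_bij) -(card_hom_codom _ f_bij).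
rewrite card_hom_prod_codom card_hom_prod_dom; last exact: dual_mulC.
have sub_ok (K : {group A}) : #|K| < #|A| ->
    #|hom (subg_of K) (dual n X)| = #|hom X (subg_of K)|.
  move=> ltKA; apply: IHm.
  - by rewrite card_subg_of (leq_trans ltKA).
  - by move=> u v; apply: val_inj; apply: Ac.
  - by move=> u; apply: val_inj; rewrite /= morphX ?inE // expA.
by rewrite !sub_ok.
Qed.

Lemma card_hom_self_dual n (G X : finGroupType) :
  #|hom (dual n G) (dual n X)| = #|hom X (dual n G)|.
Proof. by apply: card_hom_dual; [apply: dual_mulC | apply: dual_expn]. Qed.

Lemma card_hom_of_prod_dual n (G H X : finGroupType)
    (f : hom (G * dual n G)%type (H * dual n H)%type) :
  bijective f -> #|hom X G| = #|hom X H|.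
Proof.
move=> f_bij; have := card_hom_dom (dual n X) f_bij.
rewrite !card_hom_prod_dom; try exact: dual_mulC.
rewrite !card_hom_self_dual ![#|hom _ (dual n X)|]card_hom_dualC => /eqP.
rewrite !mulnn eqn_sqr => /eqP dualGH.
have := card_hom_codom X f_bij; rewrite !card_hom_prod_codom dualGH => /eqP.
rewrite eqn_pmul2r => [/eqP//|].
(* The trivial homomorphism makes the cancelled factor positive. *)
have M1 : {morph (fun _ : X => 1 : dual n H) : x y / x * y}.
  by move=> x y; rewrite mulg1.
by apply/card_gt0P; exists (mkhom M1).
Qed.

(** * Kernels and Lovasz's theorem *)

Definition hker (X Y : finGroupType) (f : hom X Y) : {set X} :=
  [set x | f x == 1].

Section Kernel.
Variables X Y : finGroupType.

Lemma hker_normal (f : hom X Y) : group_set (hker f) && (hker f <| setT).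
Proof.
have grp : group_set (hker f).
  apply/group_setP; rewrite inE hom1; split=> // x y.
  by rewrite !inE homM => /eqP-> /eqP->; rewrite mulg1.
rewrite grp /normal subsetT; apply/subsetP=> x _; rewrite inE.
apply/subsetP=> _ /imsetP[y yker ->]; move: yker.
rewrite !inE conjgE !homM => /eqP->.
by rewrite mul1g homV mulVg.
Qed.

Lemma hker_inj (f : hom X Y) : injective f -> hker f = 1.
Proof.
move=> f_inj; apply/setP=> x; rewrite !inE -(inj_eq f_inj).
by rewrite hom1.
Qed.

Lemma inj_of_hker (f : hom X Y) : hker f = 1 -> injective f.
Proof.
move=> ker1; apply: hom_inj => x fx; apply/set1P.
by rewrite -[[set 1]]ker1 inE fx.
Qed.

End Kernel.

Lemma card_hker_quotient (X Y : finGroupType) (N : {group X}) : N <| setT ->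
  #|[set f : hom X Y | hker f == N]| =
  #|[set f : hom (coset_of N) Y | hker f == 1]|.
Proof.
move=> nN; have inN x : x \in 'N(N) by rewrite (subsetP (normal_norm nN)) ?inE.
have piM : {morph coset N : x y / x * y} by move=> x y; rewrite morphM.
pose pi := mkhom piM.
have piE x : pi x = coset N x by rewrite mkhomE.
have comp_inj : injective (fun g : hom (coset_of N) Y => hom_comp g pi).
  move=> g1 g2 g12; apply/hom_eq=> xbar; rewrite -(coset_reprK xbar) -piE.
  by rewrite -!hom_compE g12.
rewrite -[RHS](card_imset _ comp_inj); apply: eq_card => /= f; rewrite inE.
apply/eqP/imsetP=> [kerf|[g]]; last first.
  rewrite inE => /eqP ker1 ->; have g_inj := inj_of_hker ker1; apply/setP=> x.
  rewrite inE hom_compE -[X in _ == X](hom1 g) (inj_eq g_inj) piE.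
  by apply/eqP/idP=> [/coset_idr|/coset_id]; auto.
(* [f] is constant on cosets of its kernel, so evaluation at representatives descends it to the
   quotient. *)
have f_repr (x : X) : f (repr (coset N x)) = f x.
  have : repr (coset N x) \in N :* x.
    by rewrite -val_coset ?inN //; apply: mem_repr_coset.
  by case/rcosetP=> y; rewrite -kerf inE => /eqP fy ->; rewrite homM fy mul1g.
have gM : {morph (fun xbar : coset_of N => f (repr xbar)) : x y / x * y}.
  by move=> x y; rewrite -homM -[RHS]f_repr piM !coset_reprK.
exists (mkhom gM).
  rewrite inE; apply/eqP/hker_inj/hom_inj => xbar; rewrite mkhomE => fx1.
  have Nx : repr xbar \in N.
    by move/setP/(_ (repr xbar)): kerf => <-; rewrite inE fx1.
  by rewrite -(coset_reprK xbar); apply: coset_id.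
by apply/hom_eq=> x; rewrite hom_compE piE mkhomE f_repr.
Qed.

Lemma card_hom_hker (X Y : finGroupType) :
  #|hom X Y| = (\sum_(N : {set X}) #|[set f : hom X Y | hker f == N]|)%N.
Proof.
rewrite -sum1_card (partition_big (@hker X Y) xpredT) //=.
by apply: eq_bigr => N _; rewrite sum1dep_card.
Qed.

(* Homomorphisms with kernel N correspond to injective homomorphisms from     *)
(* the quotient by N, so injective homomorphisms are counted by induction.    *)
Lemma card_inj_hom (G H : finGroupType) :
    (forall X : finGroupType, #|hom X G| = #|hom X H|) ->
  forall X : finGroupType,
    #|[set f : hom X G | hker f == 1]| = #|[set f : hom X H | hker f == 1]|.
Proof.
move=> homGH X; have [m] := ubnP #|X|; elim: m X => // m IHm X leX.
have := homGH X; rewrite !card_hom_hker (bigD1 1) //= [RHS](bigD1 1) //=.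
suff -> : (\sum_(N : {set X} | N != 1%g) #|[set f : hom X G | hker f == N]| =
           \sum_(N : {set X} | N != 1%g) #|[set f : hom X H | hker f == N]|)%N.
  by move/addIn.
apply: eq_bigr => N N1.
case: (boolP (group_set N && (N <| setT))) => [/andP[gN nN]|no].
  rewrite !(card_hker_quotient _ (N := Group gN)) //; apply: IHm.
  apply: leq_trans (_ : _ < #|X|) leX.
  have quoT : [set: coset_of (Group gN)] = [set: X] / Group gN.
    apply/setP=> xbar; rewrite inE -(coset_reprK xbar); apply/esym.
    by rewrite mem_quotient ?inE.
  by rewrite -!cardsT quoT ltn_quotient ?subsetT.
(* A subset that is not a normal subgroup is no kernel and contributes zero on both sides. *)
suff none (Y : finGroupType) : [set f : hom X Y | hker f == N] = set0.
  by rewrite !none !cards0.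
apply/setP=> f; rewrite !inE; apply: contraNF no => /eqP <-.
exact: hker_normal.
Qed.

(** The identity is an injective map G -> G, so the equal count of injective maps G -> H is
    positive; the same holds with G and H exchanged, and finiteness turns an embedding into an
    isomorphism. *)
Lemma isog_of_card_hom (G H : finGroupType) :
    (forall X : finGroupType, #|hom X G| = #|hom X H|) ->
  [set: G] \isog [set: H].
Proof.
move=> homGH.
have emb (A B : finGroupType) :
    (#|[set f : hom A A | hker f == 1]| = #|[set f : hom A B | hker f == 1]|) ->
    exists f : hom A B, injective f.
  move=> eqAB; have: 0 < #|[set f : hom A B | hker f == 1]|.
    have idM : {morph (@id A) : x y / x * y} by [].
    rewrite -eqAB; apply/card_gt0P; exists (mkhom idM); rewrite inE.
    by apply/eqP/hker_inj => x y; rewrite !mkhomE.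
  by case/card_gt0P=> f; rewrite inE => /eqP ker1; exists f; apply: inj_of_hker.
have [f f_inj] := emb G H (card_inj_hom homGH G).
have [g g_inj] := emb H G (esym (card_inj_hom homGH H)).
apply: (isog_of_hom f_inj); apply/eqP.
by rewrite eqn_leq (leq_card f) // (leq_card g).
Qed.

(** * Grouplike elements of the double *)

Import GRing.Theory.
Local Open Scope ring_scope.
Local Open Scope tens_scope.

Definition grouplike (k : fieldType) (A : hopfType k) (x : A) : Prop :=
  comul x = x \ox x /\ counit x = 1 :> k.

Lemma linear_inverse (k : fieldType) (U V : lmodType k) (f : {linear U -> V})
    (g : V -> U) : cancel f g -> cancel g f -> linear g.
Proof. by move=> fK gK c u v; apply: (can_inj fK); rewrite linearP !gK. Qed.

Lemma grouplike_hopf_iso (k : fieldType) (A B : hopfType k)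
    (f : {lrmorphism A -> B}) (x : A) :
  hopf_morphism f -> bijective f -> grouplike (f x) <-> grouplike x.
Proof.
case=> comul_f counit_f _ [g fK gK]; rewrite /grouplike counit_f comul_f.
have tens_fE (v w : A) : tens_map f f (v \ox w) = f v \ox f w.
  exact: tens_mapE.
split=> -[comul_x ->]; split=> //; last by rewrite comul_x tens_fE.
have g_lin : linear g.
  exact: linear_inverse fK gK.
pose gL : {linear B -> A} :=
  HB.pack g (GRing.isLinear.Build k B A *:%R g g_lin).
(* Reflecting grouplikes requires f (x) f to be injective; the linear inverse of [f] supplies a left
   inverse. *)
have tens_gK : tens_map gL gL \o tens_map f f =1 idfun.
  apply: tens_eq => v w /=; rewrite tens_fE.
  by rewrite (tens_mapE gL gL) /= !fK.
have := tens_gK (comul x); rewrite /= comul_x -tens_fE => <-.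
exact: (tens_gK (x \ox x)).
Qed.

Section GrouplikeDouble.
Variables (k : fieldType) (G : finGroupType).
Local Notation D := (drinfeld_double k G).

Definition dglike (h : G) (chi : G -> k) : D := \sum_a chi a *: dbasis k a h.

Lemma dglikeE h chi a b :
  (dglike h chi : {ffun _ -> k^o}) (a, b) = if b == h then chi a else 0.
Proof.
rewrite /dglike sum_ffunE (bigD1 a) //= big1 ?addr0 => [|c ca].
  rewrite !ffunE xpair_eqE eqxx /=.
  by case: eqP => _; rewrite /GRing.scale /= ?mulr1 ?mulr0.
by rewrite !ffunE xpair_eqE eq_sym (negbTE ca) scaler0.
Qed.

(** The product of e_a # h and e_b # h' survives only for b = a ^ h. The hypothesis holds for
    characters, which are class functions. *)
Lemma dglikeM h h' chi chi' : (forall a, chi' (a ^ h)%g = chi' a) ->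
  dglike h chi * dglike h' chi' = dglike (h * h')%g (fun a => chi a * chi' a).
Proof.
move=> chiJ; rewrite /dglike mulr_suml; apply: eq_bigr => a _.
rewrite mulr_sumr (bigD1 (a ^ h)%g) //= big1 ?addr0 => [|b nb].
  rewrite -scalerAl -scalerAr scalerA dbasisM chiJ conjgE.
  by rewrite !mulgA mulgV mul1g mulgK eqxx.
rewrite -scalerAl -scalerAr dbasisM.
case: eqP => [ab|]; last by rewrite !scaler0.
by case/eqP: nb; rewrite ab conjgE !mulgA mulVg mul1g mulgKV.
Qed.

Lemma grouplike_dglike h chi : chi 1%g = 1 ->
  (forall a b, chi (a * b)%g = chi a * chi b) -> grouplike (dglike h chi).
Proof.
move=> chi1 chiM; split; last first.
  rewrite /dglike linear_sum (bigD1 1%g) //= big1 ?addr0 => [|a na].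
    by rewrite linearZ /= [counit _]dcounitE eqxx chi1; apply: mulr1.
  by rewrite linearZ /= [counit _]dcounitE (negbTE na); apply: mulr0.
rewrite {1 3}/dglike !linear_sum /=.
under eq_bigr => a _.
  rewrite linearZ /= [comul _]dcomulE1 scaler_sumr; over.
rewrite exchange_big /=; apply: eq_bigr => a _.
rewrite linearZ /= /dglike pure_tens_suml scaler_sumr.
rewrite (reindex_inj (mulgI a)) /=; apply: eq_bigr => b _.
rewrite mulKg chiM -scalerA; congr (_ *: _).
by have := pure_tens_linearl (dbasis k a h) (chi b) (dbasis k b h) 0;
  rewrite pure_tens0l !addr0 => ->.
Qed.

(** This turns the grouplike equation into scalar equations on coordinates. The product is a * b,
    with [b] from the first tensor factor, because the coalgebra of functions is co-opposite. *)
Lemma comul_coord (x : D) b h a h' :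
  tens_lift (fun v w : D => (v : {ffun _ -> k^o}) (b, h)
    * (w : {ffun _ -> k^o}) (a, h') : k^o) (comul x) =
  if h == h' then (x : {ffun _ -> k^o}) (a * b, h)%g else 0.
Proof.
move: x; apply: (double_eq (U := k^o)
  (f := fun x : D => tens_lift _ (comul x))) => [c x y|c x y|g d].
- by rewrite !linearP.
- by case: eqP => _; rewrite ?scaler0 ?addr0 // !ffunE.
rewrite [comul _]dcomulE1 linear_sum /=.
under eq_bigr => e _.
  rewrite tens_liftE; first over.
  - by move=> v c w w'; rewrite !ffunE mulrDr /GRing.scale /= mulrCA.
  - by move=> w c v v'; rewrite !ffunE mulrDl /GRing.scale /= mulrA.
rewrite (bigD1 a) //= big1 ?addr0 => [|e ne]; last first.
  by rewrite !ffunE !xpair_eqE [a == e]eq_sym (negbTE ne) mulr0.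
rewrite !ffunE !xpair_eqE eqxx /=.
have -> : (b == a^-1 * g)%g = (a * b == g)%g.
  by rewrite -(inj_eq (mulgI a)) mulKVg.
case: (h =P h') => [<-|hh'].
  by case: (_ == g); case: (h == d); rewrite /= ?mulr0 ?mulr1 ?mul0r.
case: (h =P d) => [<-|]; last by rewrite andbF mul0r.
by rewrite [h' == h]eq_sym (introF eqP hh') mulr0.
Qed.

Lemma dglike_grouplike (x : D) : grouplike x ->
  exists h chi, [/\ x = dglike h chi, chi 1%g = 1
    & forall a b, chi (a * b)%g = chi a * chi b].
Proof.
case=> comul_x counit_x; pose X := (x : {ffun _ -> k^o}).
have coordM b h a h' :
    X (b, h) * X (a, h') = if h == h' then X (a * b, h)%g else 0.
  rewrite -comul_coord comul_x tens_liftE //.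
  - by move=> v c w w'; rewrite !ffunE mulrDr /GRing.scale /= mulrCA.
  - by move=> w c v v'; rewrite !ffunE mulrDl /GRing.scale /= mulrA.
(* The counit sums the coordinates at (1, h), so they cannot all vanish. *)
have [h Xh|X0] := pickP (fun h => X (1%g, h) != 0); last first.
  move/eqP: counit_x; rewrite -[counit x]/(dcounit x) /dcounit /dlift big1.
    by rewrite eq_sym oner_eq0.
  case=> g h _ /=; case: eqP => [->|_]; last exact: mulr0.
  by have /negbFE/eqP := X0 h; rewrite /X => ->; apply: mul0r.
(* Products of coordinates with different second indices vanish, so only the index [h] survives. *)
have X0 a h' : h' != h -> X (a, h') = 0.
  move=> h'h; apply/eqP; have /eqP := coordM a h' 1%g h.
  by rewrite (negbTE h'h) mulf_eq0 (negbTE Xh) orbF.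
exists h, (fun a => X (a, h)); split.
- by apply/ffunP=> -[a b]; rewrite dglikeE; case: eqP => [->//|/eqP/X0].
- by apply: (mulfI Xh); rewrite coordM eqxx mulg1 mulr1.
- by move=> a b; rewrite mulrC coordM eqxx.
Qed.

End GrouplikeDouble.

(** * Characters as exponents of a primitive root of unity *)

Lemma closed_prim_root (k : closedFieldType) n : [pchar k] =i pred0 ->
  exists z : k, n.+1.-primitive_root z.
Proof.
move=> /pcharf0P k0; pose p : {poly k} := 'X^(n.+1) - 1%:P.
have [r def_p] := closed_field_poly_normal p.
have monic_p : lead_coef p = 1 by apply/eqP/monicXnsubC.
rewrite monic_p scale1r in def_p.
(* In characteristic zero X^(n+1) - 1 is separable, so it has n+1 distinct roots, and one of them is
   primitive. *)
have uniq_r : uniq r.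
  by rewrite -separable_prod_XsubC -def_p separable_Xn_sub_1 // k0.
have size_r : size r = n.+1.
  have := size_XnsubC (1 : k) (ltn0Sn n).
  by rewrite -/p def_p size_prod_XsubC => -[].
have unity_r : all n.+1.-unity_root r.
  apply/allP=> x xr; rewrite unity_rootE -subr_eq0.
  have : root p x by rewrite def_p root_prod_XsubC.
  by rewrite /root /p !hornerE.
have /hasP[z _ prim_z] :=
  has_prim_root (ltn0Sn n) unity_r uniq_r (eq_leq (esym size_r)).
by exists z.
Qed.

Section DualRoot.
Variables (k : fieldType) (n : nat) (z : k).
Hypothesis prim_z : n.+1.-primitive_root z.

Definition zeta (i : 'I_n.+1) : k := z ^+ i.

Lemma zetaM i j : zeta (i * j)%g = zeta i * zeta j.
Proof. by rewrite /zeta /= (prim_expr_mod prim_z) exprD. Qed.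

Lemma zeta1 : zeta 1%g = 1.
Proof. exact: expr0. Qed.

Lemma zeta_inj : injective zeta.
Proof.
move=> i j /eqP; rewrite /zeta (eq_prim_root_expr prim_z) !modn_small //.
by move/eqP/val_inj.
Qed.

Section Double.
Variable G : finGroupType.

Definition double_glike (p : G * dual n G) : drinfeld_double k G :=
  dglike p.1 (fun a => zeta ((p.2 : dual n G) a)).

Lemma double_glikeM p q :
  double_glike (p * q)%g = double_glike p * double_glike q.
Proof.
case: p q => [g u] [h v]; rewrite /double_glike dglikeM /=; last first.
  by move=> a; rewrite dualJ.
rewrite /dglike; apply: eq_bigr => a _; congr (_ *: _).
by rewrite -zetaM -dualM.
Qed.

Lemma double_glike_inj : injective double_glike.
Proof.
move=> [g u] [h v] /ffunP uv; have gh : g = h.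
  have := uv (1%g, g); rewrite !dglikeE eqxx !hom1 zeta1 /=.
  by case: eqP => // _ /eqP; rewrite oner_eq0.
rewrite gh in uv *; congr pair; apply/hom_eq=> a; apply: zeta_inj.
by have := uv (a, h); rewrite !dglikeE eqxx.
Qed.

Lemma grouplike_double_glike p : grouplike (double_glike p).
Proof.
by apply: grouplike_dglike => [|a b]; rewrite ?hom1 ?zeta1 // homM zetaM.
Qed.

(** Since |G| divides n+1, character values are (n+1)-st roots of unity, hence powers of [z], and
    the character lifts through [zeta]. *)
Lemma double_glike_onto x : (#|G| %| n.+1)%N -> grouplike x ->
  exists p, double_glike p = x.
Proof.
move=> /dvdnP[m Gn] /dglike_grouplike[h [chi [-> chi1 chiM]]].
have chiX a i : chi (a ^+ i)%g = chi a ^+ i.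
  by elim: i => [|i IHi]; rewrite ?expg0 ?expr0 // expgS exprS chiM IHi.
have [a|u uP] := fin_all_exists (P := fun a i => zeta i = chi a).
  have chi_n : chi a ^+ n.+1 = 1.
    rewrite -chiX -[RHS]chi1; congr chi; apply/eqP.
    by rewrite -order_dvdn Gn dvdn_mull // -cardsT order_dvdG ?inE.
  by have [i ->] := prim_rootP prim_z chi_n; exists i.
have uM : {morph u : a b / (a * b)%g}.
  by move=> a b; apply: zeta_inj; rewrite zetaM !uP chiM.
exists (h, mkhom uM : dual n G); apply: eq_bigr => a _.
by rewrite mkhomE uP.
Qed.

End Double.

Lemma hopf_isomorphic_grouplike (G H : finGroupType) :
    (#|G| %| n.+1)%N -> (#|H| %| n.+1)%N ->
    hopf_isomorphic (drinfeld_double k G) (drinfeld_double k H) ->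
  exists f : hom (G * dual n G)%type (H * dual n H)%type, bijective f.
Proof.
move=> Gn Hn [F F_hopf F_bij]; have Fgl := grouplike_hopf_iso _ F_hopf F_bij.
have [p|f fP] := fin_all_exists
  (P := fun p q => double_glike q = F (double_glike p)).
  by apply: double_glike_onto => //; apply/Fgl/grouplike_double_glike.
have [q|g gP] := fin_all_exists
  (P := fun q p => double_glike q = F (double_glike p)).
  case: F_bij => F' FK F'K.
  have [|p pE] := @double_glike_onto _ (F' (double_glike q)) Gn.
    by apply/Fgl; rewrite F'K; apply: grouplike_double_glike.
  by exists p; rewrite pE F'K.
have fM : {morph f : p q / (p * q)%g}.
  move=> p q; apply: double_glike_inj.
  by rewrite double_glikeM !fP double_glikeM rmorphM.
exists (mkhom fM); exists g => [p|q]; rewrite mkhomE.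
  by apply/double_glike_inj/(bij_inj F_bij); rewrite -gP fP.
by apply: double_glike_inj; rewrite fP -gP.
Qed.

End DualRoot.

(** * Functoriality of the double *)

Section Relabel.
Variables (k : fieldType) (G H : finGroupType) (f : hom G H).

Definition drelabel : drinfeld_double k G -> drinfeld_double k H :=
  dlift (fun g h => dbasis k (f g) (f h)).
HB.instance Definition _ := GRing.Linear.copy drelabel (dlift _).

Lemma drelabelE g h : drelabel (dbasis k g h) = dbasis k (f g) (f h).
Proof. exact: dliftE. Qed.

End Relabel.

Lemma drelabelK (k : fieldType) (G H : finGroupType) (f : hom G H)
  (g : hom H G) : cancel f g -> cancel (@drelabel k G H f) (@drelabel k H G g).
Proof.
move=> fK; apply: (double_eq (f := fun x => drelabel g (drelabel f x))
  (f' := idfun)) => [c x y|c x y|a b]; rewrite ?linearP //.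
by rewrite !drelabelE !fK.
Qed.

Section RelabelMorphism.
Variables (k : fieldType) (G H : finGroupType) (f : hom G H).
Local Notation F := (@drelabel k G H f).
Hypothesis f_bij : bijective f.
Let f_inj := bij_inj f_bij.

(** Surjectivity of [f] enters in the unit, a sum over the whole group; injectivity makes the delta
    conditions in the products agree. *)
Lemma drelabel_monoid : monoid_morphism F.
Proof.
split.
  rewrite !dunitE linear_sum [RHS](reindex f) /=; last exact: onW_bij.
  by apply: eq_bigr => g _; rewrite drelabelE hom1.
move=> x y; move: x.
apply: (double_eq (f := fun x => F (x * y))
  (f' := fun x => F x * F y)) => [c x z|c x z|g g'].
- by rewrite mulrDl -scalerAl linearP.
- by rewrite linearP mulrDl scalerAl.
move: y; apply: (double_eq (f := fun y => F (_ * y))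
  (f' := fun y => F _ * F y)) => [c x z|c x z|h h'].
- by rewrite mulrDr -scalerAr linearP.
- by rewrite linearP mulrDr scalerAr.
rewrite dbasisM !drelabelE dbasisM -homV -!homM (inj_eq f_inj).
by case: ifP => _; rewrite ?linear0 ?drelabelE.
Qed.
HB.instance Definition _ :=
  GRing.isMonoidMorphism.Build _ _ F drelabel_monoid.

Lemma drelabel_hopf : hopf_morphism F.
Proof.
split=> x.
- move: x; apply: (double_eq (f := fun x => comul (F x))
    (f' := fun x => tens_map F F (comul x))) => [c x y|c x y|g h];
    rewrite ?linearP //.
  rewrite drelabelE [LHS]dcomulE1 [comul (dbasis _ _ _)]dcomulE1 linear_sum /=.
  rewrite (reindex f) /=; last exact: onW_bij.
  by apply: eq_bigr => a _; rewrite tens_mapE /= !drelabelE homM homV.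
- move: x; apply: (double_eq (U := k^o) (f := fun x => counit (F x))
    (f' := fun x => counit x)) => [c x y|c x y|g h]; rewrite ?linearP //.
  rewrite drelabelE [LHS]dcounitE [RHS]dcounitE.
  by rewrite -(hom1 f) (inj_eq f_inj).
- move: x; apply: (double_eq (f := fun x => antipode (F x))
    (f' := fun x => F (antipode x))) => [c x y|c x y|g h];
    rewrite ?linearP //.
  rewrite drelabelE [LHS]dantipodeE [antipode (dbasis _ _ _)]dantipodeE.
  by rewrite drelabelE !homM !homV.
Qed.

Lemma hopf_isomorphic_drelabel :
  hopf_isomorphic (drinfeld_double k G) (drinfeld_double k H).
Proof.
have [g [fK gK]] := hom_inverse f_bij.
exists F; first exact: drelabel_hopf.
by exists (drelabel g); apply: drelabelK.
Qed.

End RelabelMorphism.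

Lemma hom_of_isog (G H : finGroupType) :
  ([set: G] \isog [set: H])%g -> exists f : hom G H, bijective f.
Proof.
case/isogP=> m m_inj m_im; have mM : {morph m : x y / (x * y)%g}.
  by move=> x y; rewrite morphM ?inE.
exists (mkhom mM); apply: inj_card_bij => [x y|].
  by rewrite !mkhomE; apply: (injmP m_inj); rewrite inE.
by rewrite -!cardsT -m_im card_injm.
Qed.

Local Close Scope ring_scope.
Local Close Scope tens_scope.

Theorem theorem2p5 (k : closedFieldType) (k_char0 : [pchar k]%R =i pred0)
    (G H : finGroupType) :
  hopf_isomorphic (drinfeld_double k G) (drinfeld_double k H)
    <-> [set: G] \isog [set: H].
Proof.
split=> [isoGH|/hom_of_isog[f f_bij]]; last first.
  exact: hopf_isomorphic_drelabel f_bij.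
pose N := (#|G| * #|H|)%N.
have N_gt0 : 0 < N by rewrite muln_gt0 -!cardsT !cardG_gt0.
(* The root has order [N.-1.+1], which is N, a common multiple of both group orders. *)
have [z prim_z] := closed_prim_root N.-1 k_char0.
have [||f f_bij] := hopf_isomorphic_grouplike prim_z _ _ isoGH.
- by rewrite prednK // dvdn_mulr.
- by rewrite prednK // dvdn_mull.
by apply: isog_of_card_hom => X; apply: card_hom_of_prod_dual f_bij.
Qed.
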